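(* Let $\{E_\alpha\}_{\alpha \in A}$ be a family of preordered topological vector spaces, with positive cones $E_\alpha^+$. Then the following are equivalent: (i) the positive cone of the linear topological direct sum $\bigoplus^{\mathrm{lin}}_\alpha E_\alpha$ is semisimple; (ii) the positive cone of the topological product $\prod_\alpha E_\alpha$ is semisimple; (iii) for every $\alpha \in A$, the positive cone of $E_\alpha$ is semisimple. If each $E_\alpha$ is locally convex, then the preceding conditions are also equivalent to: (iv) the positive cone of the locally convex direct sum $\bigoplus^{\mathrm{lc}}_\alpha E_\alpha$ is semisimple.
   Context: All vector spaces are real and all topological vector spaces are Hausdorff. A convex cone is a non-empty subset $\mathcal{K}$ with $\mathcal{K}+\mathcal{K}\subseteq\mathcal{K}$ and $\lambda\mathcal{K}\subseteq\mathcal{K}$ for all $\lambda\ge0$. A preordered topological vector space is a topological vector space $E$ equipped with a convex cone $E_+$ (its positive cone). The cone $E_+$ is semisimple if the continuous linear functionals on $E$ that are non-negative on $E_+$ separate points on $E$, i.e. for every $x\ne0$ there is such a functional $\varphi$ with $\varphi(x)\neq0$. $\prod_\alpha E_\alpha$ carries the product topology. $\bigoplus^{\mathrm{lin}}_\alpha E_\alpha$ is the algebraic direct sum $\bigoplus_\alpha E_\alpha$ with the finest linear (vector space) topology for which all canonical injections $\iota_\beta:E_\beta\to\bigoplus_\alpha E_\alpha$ are continuous. If all $E_\alpha$ are locally convex, $\bigoplus^{\mathrm{lc}}_\alpha E_\alpha$ is the same vector space with the finest locally convex topology for which all $\iota_\beta$ are continuous. The product and the direct sums are preordered by the pointwise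 cones $\prod_\alpha E_\alpha^+$ and $\bigoplus_\alpha E_\alpha^+$ respectively. *)

(* Defs.v *)
From HB Require Import structures.
From mathcomp Require Import all_boot all_order all_algebra.
From mathcomp Require Import all_classical reals interval_inference topology.
From mathcomp Require Import num_normedtype convex tvs.

Set Implicit Arguments.
Unset Strict Implicit.
Unset Printing Implicit Defensive.

Import Order.TTheory GRing.Theory Num.Theory.
Import numFieldTopology.Exports.

Local Open Scope classical_set_scope.
Local Open Scope ring_scope.

(* A topology on the carrier of [V] is a class [tau : Topological V]; the
   resulting topological space is [Topological.Pack tau]. *)
Section VectorTopology.
Context {R : realType} {V : lmodType R}.

Definition vector_topology (tau : Topological V) : Prop :=
  let W := Topological.Pack tau in
  continuous (fun z : W * W => (z.1 : V) + (z.2 : V) : W) /\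
  continuous (fun z : R^o * W => z.1 *: (z.2 : V) : W).

(* For a vector topology, this is local convexity as in [tvsType]. *)
Definition convex_topology (tau : Topological V) : Prop :=
  exists2 B : set (set V), (forall b, b \in B -> convex_set b) &
    @basis (Topological.Pack tau) B.

Section sup.
Variables (I : Type) (Tc : I -> Topological V).

Lemma cvg_sup_le i (x : sup_topology Tc) :
  nbhs x --> (x : Topological.Pack (Tc i)).
Proof. by apply: (proj1 (@cvg_sup V I Tc (nbhs x) x _) _ i); exact: cvg_id. Qed.

Lemma sup_vector_topology : (forall i, vector_topology (Tc i)) ->
  vector_topology (Topological.class (sup_topology Tc)).
Proof.
move=> vTc; split=> [[x y]|[k x]].
  apply/(@cvg_sup V I Tc) => i; apply: cvg_trans (proj1 (vTc i) (x, y)).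
  apply: cvg_app => U [[U1 U2] /= [/cvg_sup_le nU1 /cvg_sup_le nU2] sU].
  by exists (U1, U2).
apply/(@cvg_sup V I Tc) => i; apply: cvg_trans (proj2 (vTc i) (k, x)).
apply: cvg_app => U [[U1 U2] /= [nU1 /cvg_sup_le nU2] sU].
by exists (U1, U2).
Qed.

Lemma sup_convex_topology : (forall i, convex_topology (Tc i)) ->
  convex_topology (Topological.class (sup_topology Tc)).
Proof.
move=> cTc.
exists [set b : set V | @open (sup_topology Tc) b /\ convex_set b].
  by move=> b /[!inE] -[].
split=> [b []//|x].
have FF : Filter (filter_from
    [set U : set V | (@open (sup_topology Tc) U /\ convex_set U) /\ U x] id).
  apply: filter_from_filter.
    exists setT; split=> //; split; first exact: (@openT (sup_topology Tc)).
    by move=> ? ? ? _ _; rewrite inE.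
  move=> U1 U2 [[oU1 cU1] U1x] [[oU2 cU2] U2x].
  exists (U1 `&` U2) => //; split=> //; split; first exact: openI.
  move=> y z l; rewrite !in_setI => /andP[yU1 yU2] /andP[zU1 zU2].
  by rewrite cU1// cU2.
apply/(@cvg_sup V I Tc) => i U Ux; have [B cB [oB bB]] := cTc i.
have [b [Bb bx] bU] := bB x U Ux.
exists b => //; split=> //; split; last by apply: cB; rewrite inE.
rewrite openE => y /= yb; apply: (@cvg_sup_le i).
by apply: open_nbhs_nbhs; split=> //; exact: oB.
Qed.
End sup.

Section initial.
Variables (E : topologicalLmodType R) (f : {linear V -> E}).

Lemma initial_cvg (F : set_system V) (x : V) : Filter F ->
  f @ F --> f x -> F --> (x : initial_topology f).
Proof.
move=> FF cf U [_ [[O oO <-] Ox] OU]; apply: filterS OU _.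
by apply: cf; apply: open_nbhs_nbhs.
Qed.

Lemma initial_vector_topology :
  vector_topology (Topological.class (initial_topology f)).
Proof.
have cf (x : initial_topology f) : f @ nbhs x --> f x.
  exact: (@initial_continuous V E f).
split=> [[x y]|[k x]]; apply: initial_cvg => U /=.
  rewrite linearD => /(@add_continuous E (f x, f y))[[U1 U2] /= [nU1 nU2] sU].
  exists (f @^-1` U1, f @^-1` U2) => /=.
    by split; [exact: (cf x)|exact: (cf y)].
  by move=> [a b] /= [? ?]; rewrite linearD; exact: (sU (f a, f b)).
rewrite linearZ => /(@scale_continuous R E (k, f x))[[U1 U2] /= [nU1 nU2] sU].
exists (U1, f @^-1` U2) => /=; first by split; [|exact: (cf x)].
by move=> [a b] /= [? ?]; rewrite linearZ; exact: (sU (a, f b)).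
Qed.
End initial.

End VectorTopology.

Definition is_locally_convex (R : realType) (E : topologicalLmodType R) :
    Prop :=
  convex_topology (Topological.class E).

Lemma initial_convex_topology (R : realType) (V : lmodType R)
    (E : topologicalLmodType R) (f : {linear V -> E}) : is_locally_convex E ->
  convex_topology (Topological.class (initial_topology f)).
Proof.
move=> [B cB [oB bB]]; exists [set f @^-1` b | b in B].
  move=> _ /[!inE] -[b Bb <-] x y l /[!inE]/= bx byy.
  apply/set_mem; rewrite linearD !linearZ.
  by apply: (cB b _ (f x) (f y) l); rewrite inE.
split=> [_ [b Bb <-]|x U [_ [[O oO <-] Ox] OU]].
  by exists b => //; exact: oB.
have [b [Bb bx] bO] := bB (f x) O (open_nbhs_nbhs (conj oO Ox)).
by exists (f @^-1` b); [split=> //; exists b|move=> y /bO /OU].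
Qed.

Section DirectProduct.
Context {R : realType} {A : Type}.

Section lmod.
Variable E : A -> lmodType R.
Local Notation P := (prod_topology (fun a => E a : Type)).
Implicit Types x y z : P.

Let padd x y : P := fun a => x a + y a.
Let popp x : P := fun a => - x a.
Let pscale (k : R) x : P := fun a => k *: x a.

Let paddA : associative padd.
Proof.
by move=> x y z;
apply: functional_extensionality_dep => a; exact: addrA. Qed.
Let paddC : commutative padd.
Proof.
by move=> x y;
apply: functional_extensionality_dep => a; exact: addrC. Qed.
Let padd0 : left_id (fun a => 0 : E a) padd.
Proof.
by move=> x;
apply: functional_extensionality_dep => a; exact: add0r. Qed.
Let paddN : left_inverse (fun a => 0 : E a) popp padd.
Proof.
by move=> x;
apply: functional_extensionality_dep => a; exact: addNr. Qed.

HB.instance Definition _ := Choice.copy P (forall a, E a).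
HB.instance Definition _ := GRing.isZmodule.Build P paddA paddC padd0 paddN.

Let pscaleA k l x : pscale k (pscale l x) = pscale (k * l) x.
Proof. by apply: functional_extensionality_dep => a; exact: scalerA. Qed.
Let pscale1 : left_id 1 pscale.
Proof.
by move=> x;
apply: functional_extensionality_dep => a; exact: scale1r. Qed.
Let pscaleDr : right_distributive pscale +%R.
Proof.
by move=> k x y;
apply: functional_extensionality_dep => a; exact: scalerDr. Qed.
Let pscaleDl x : {morph pscale^~ x : k l / k + l}.
Proof.
by move=> k l;
apply: functional_extensionality_dep => a; exact: scalerDl. Qed.

HB.instance Definition _ :=
  GRing.Zmodule_isLmodule.Build R P pscaleA pscale1 pscaleDr pscaleDl.

Definition dproj (a : A) (x : P) : E a := x a.

Let dproj_linear a : linear (@dproj a). Proof. by []. Qed.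
HB.instance Definition _ a :=
  GRing.isLinear.Build R P (E a) *:%R (@dproj a) (dproj_linear a).
End lmod.

End DirectProduct.

Section DirectProductTopology.
Context {R : realType} {A : Type} (E : A -> topologicalLmodType R).

Local Notation P := (prod_topology (fun a => E a : Type)).

Lemma prod_vector_topology : @vector_topology R P (Topological.class P).
Proof.
by apply: sup_vector_topology => a;
  exact: (@initial_vector_topology R P (E a) (@dproj R A E a)).
Qed.

HB.instance Definition _ := PreTopologicalNmodule_isTopologicalNmodule.Build P
  (proj1 prod_vector_topology).
HB.instance Definition _ := TopologicalNmodule_isTopologicalLmodule.Build R P
  (proj2 prod_vector_topology).

End DirectProductTopology.

Section DirectSum.
Context {R : realType} {A : Type} (E : A -> lmodType R).

Local Notation P := (prod_topology (fun a => E a : Type)).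

Definition fin_supp : {pred P} :=
  fun x => `[< finite_set [set a | x a != 0] >].

Let fin_supp_submod : submod_closed fin_supp.
Proof.
split=> [|k x y /asboolP fx /asboolP fy]; apply/asboolP.
  rewrite (_ : [set _ | _] = set0); first exact: finite_set0.
  by rewrite -subset0 => a /=; rewrite eqxx.
apply: (@sub_finite_set _ _ ([set a | x a != 0] `|` [set a | y a != 0])).
  move=> a /=; have [xa0|xa0] := eqVneq (x a) 0; last by left.
  have [ya0|ya0] := eqVneq (y a) 0; last by right.
  rewrite -[X in _ (X == 0)]/(k *: x a + y a).
  by rewrite xa0 ya0 scaler0 addr0 eqxx.
by rewrite finite_setU.
Qed.

HB.instance Definition _ :=
  GRing.isSubmodClosed.Build R P fin_supp fin_supp_submod.

Record dsum : Type := DSum { dsum_val : P ; dsum_valP : dsum_val \in fin_supp }.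

HB.instance Definition _ := [isSub for dsum_val].
HB.instance Definition _ := [Choice of dsum by <:].
HB.instance Definition _ := [SubChoice_isSubLmodule of dsum by <:].

(* [{classic A}] provides the decidable equality needed by [dfwith] *)
Let inj_fun (a : A) (u : E a) : P :=
  @dfwith {classic A} E (fun=> 0) a u.

Let inj_fun_supp a u : @inj_fun a u \in fin_supp.
Proof.
apply/asboolP; apply: (@sub_finite_set _ _ [set a]) => //= b.
have [//|ba] := pselect (b = a); move=> /eqP[].
by apply: (@dfwithout {classic A}); apply/eqP => ab; apply: ba.
Qed.

Definition dsum_inj (a : A) (u : E a) : dsum := DSum (inj_fun_supp u).

Definition dsum_proj (a : A) (x : dsum) : E a := dsum_val x a.

Let dsum_proj_linear a : linear (@dsum_proj a). Proof. by []. Qed.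
HB.instance Definition _ a :=
  GRing.isLinear.Build R dsum (E a) *:%R (@dsum_proj a) (dsum_proj_linear a).

Lemma dsum_inj_eq a u : dsum_val (@dsum_inj a u) a = u.
Proof. exact: (@dfwithin {classic A}). Qed.

Lemma dsum_inj_neq a b u : a <> b -> dsum_val (@dsum_inj a u) b = 0.
Proof. by move=> ab; apply: (@dfwithout {classic A}); exact/eqP. Qed.

End DirectSum.

Arguments dsum_inj {R A E} a u.
Arguments dsum_proj {R A E} a x.

Section DirectSumTopology.
Context {R : realType} {A : Type} (E : A -> topologicalLmodType R).

Definition inj_continuous (tau : Topological (dsum E)) : Prop :=
  forall a, continuous (dsum_inj a : E a -> Topological.Pack tau).

Definition lin_admissible (tau : Topological (dsum E)) : Prop :=
  vector_topology tau /\ inj_continuous tau.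

Definition lc_admissible (tau : Topological (dsum E)) : Prop :=
  [/\ vector_topology tau, convex_topology tau & inj_continuous tau].

Lemma sup_inj_continuous (I : Type) (Tc : I -> Topological (dsum E)) :
  (forall i, inj_continuous (Tc i)) ->
  inj_continuous (Topological.class (sup_topology Tc)).
Proof.
by move=> iTc a u; apply/(@cvg_sup (dsum E) I Tc) => i; exact: iTc.
Qed.

(* The admissible topologies are stable under suprema, so their supremum is the
   finest one: see [lin_dsum_admissible], [lin_dsum_finest],
   [lc_dsum_admissible] and [lc_dsum_finest]. *)
Definition lin_dsum : Type :=
  sup_topology (fun t : {tau | lin_admissible tau} => sval t).

Definition lc_dsum : Type :=
  sup_topology (fun t : {tau | lc_admissible tau} => sval t).

HB.instance Definition _ := Topological.copy lin_dsum
  (sup_topology (fun t : {tau | lin_admissible tau} => sval t)).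
HB.instance Definition _ := GRing.Lmodule.copy lin_dsum (dsum E).
HB.instance Definition _ := Topological.copy lc_dsum
  (sup_topology (fun t : {tau | lc_admissible tau} => sval t)).
HB.instance Definition _ := GRing.Lmodule.copy lc_dsum (dsum E).

Lemma lin_dsum_admissible : lin_admissible (Topological.class lin_dsum).
Proof.
split; first by apply: sup_vector_topology => -[tau []].
by apply: sup_inj_continuous => -[tau []].
Qed.

Lemma lin_dsum_finest (tau : Topological (dsum E)) : lin_admissible tau ->
  @open (Topological.Pack tau) `<=` @open lin_dsum.
Proof.
move=> h U; rewrite !openE => oU x Ux.
by apply: (@cvg_sup_le R (dsum E) _ _ (exist _ tau h) x); exact: oU.
Qed.

Lemma lc_dsum_admissible : lc_admissible (Topological.class lc_dsum).
Proof.
split; first by apply: sup_vector_topology => -[tau []].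
- by apply: sup_convex_topology => -[tau []].
- by apply: sup_inj_continuous => -[tau []].
Qed.

Lemma lc_dsum_finest (tau : Topological (dsum E)) : lc_admissible tau ->
  @open (Topological.Pack tau) `<=` @open lc_dsum.
Proof.
move=> h U; rewrite !openE => oU x Ux.
by apply: (@cvg_sup_le R (dsum E) _ _ (exist _ tau h) x); exact: oU.
Qed.

HB.instance Definition _ :=
  PreTopologicalNmodule_isTopologicalNmodule.Build lin_dsum
    (proj1 (proj1 lin_dsum_admissible)).
HB.instance Definition _ :=
  TopologicalNmodule_isTopologicalLmodule.Build R lin_dsum
    (proj2 (proj1 lin_dsum_admissible)).

Let lc_dsum_vector : vector_topology (Topological.class lc_dsum).
Proof. by have [] := lc_dsum_admissible. Qed.

HB.instance Definition _ :=
  PreTopologicalNmodule_isTopologicalNmodule.Build lc_dsum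
    (proj1 lc_dsum_vector).
HB.instance Definition _ :=
  TopologicalNmodule_isTopologicalLmodule.Build R lc_dsum
    (proj2 lc_dsum_vector).

(* The topology induced by one coordinate is admissible. *)
Let proj_topology a :=
  Topological.class (initial_topology (@dsum_proj R A E a)).

Let proj_topology_inj a : inj_continuous (proj_topology a).
Proof.
move=> b u; apply: (@initial_cvg R (dsum E) (E a) (@dsum_proj R A E a)).
have [ab|ab] := pselect (b = a).
  case: _ / ab; rewrite (_ : _ @ _ = nbhs u).
    have h : nbhs (dsum_val (@dsum_inj R A E b u) b) = nbhs u.
      by rewrite dsum_inj_eq.
    by move=> U /=; rewrite -/(nbhs _ U) -h.
  rewrite -fmap_comp (_ : _ \o _ = id)//.
  by apply/funext => v /=; exact: dsum_inj_eq.
rewrite -fmap_comp (_ : _ \o _ = cst 0).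
  have h : nbhs (dsum_val (@dsum_inj R A E b u) a) = nbhs (0 : E a).
    by rewrite dsum_inj_neq.
  apply: (cvg_trans (cvg_cst (0 : E a))).
  by move=> U; rewrite -h.
by apply/funext => v /=; exact: dsum_inj_neq.
Qed.

Let dsum_hausdorff (tau : Topological (dsum E)) :
  (forall a, hausdorff_space (E a)) ->
  (forall a, @open (initial_topology (@dsum_proj R A E a)) `<=`
    @open (Topological.Pack tau)) ->
  hausdorff_space (Topological.Pack tau).
Proof.
move=> hE le p q pq; apply/val_inj/functional_extensionality_dep => a.
apply: hE => U V; rewrite !nbhsE => -[U' [oU' Up] UU] [V' [oV' Vq] VV].
have [] := pq (dsum_proj a @^-1` U') (dsum_proj a @^-1` V').
- by apply: open_nbhs_nbhs; split=> //; apply: (le a); exists U'.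
- by apply: open_nbhs_nbhs; split=> //; apply: (le a); exists V'.
by move=> x [/UU Ux /VV Vx]; exists (dsum_val x a).
Qed.

Lemma lin_dsum_hausdorff :
  (forall a, hausdorff_space (E a)) -> hausdorff_space lin_dsum.
Proof.
move=> hE; apply: dsum_hausdorff => // a; apply: lin_dsum_finest; split.
  exact: (@initial_vector_topology R (dsum E) (E a) (@dsum_proj R A E a)).
exact: proj_topology_inj.
Qed.

Lemma lc_dsum_hausdorff : (forall a, is_locally_convex (E a)) ->
  (forall a, hausdorff_space (E a)) -> hausdorff_space lc_dsum.
Proof.
move=> lcE hE; apply: dsum_hausdorff => // a; apply: lc_dsum_finest; split.
- exact: (@initial_vector_topology R (dsum E) (E a) (@dsum_proj R A E a)).
- exact: (@initial_convex_topology R (dsum E) (E a) (@dsum_proj R A E a)).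
- exact: proj_topology_inj.
Qed.

End DirectSumTopology.

Definition convex_cone (R : realType) (V : lmodType R) (K : set V) : Prop :=
  [/\ K !=set0,
      forall x y, K x -> K y -> K (x + y) &
      forall (k : R) x, 0 <= k -> K x -> K (k *: x)].

Record preorderedTvs (R : realType) := PreorderedTvs {
  ptvs_sort :> topologicalLmodType R;
  ptvs_hausdorff : hausdorff_space ptvs_sort;
  pos_cone : set ptvs_sort;
  pos_cone_convex : convex_cone pos_cone
}.
Arguments pos_cone {R} p.

Definition semisimple (R : realType) (E : topologicalLmodType R) (K : set E) :
    Prop :=
  forall x : E, x != 0 ->
  exists f : {scalar E},
    [/\ continuous (f : E -> R), forall y, K y -> 0 <= f y & f x != 0].

Section PreorderedSums.
Context {R : realType} {A : Type} (E : A -> preorderedTvs R).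

Local Notation P := (prod_topology (fun a => E a : Type)).
Local Notation F := (fun a => ptvs_sort (E a)).

Definition prod_cone : set P := [set x | forall a, pos_cone (E a) (x a)].

Definition dsum_cone : set (dsum F) :=
  [set x | forall a, pos_cone (E a) (dsum_val x a)].

Let pos_cone0 a : pos_cone (E a) 0.
Proof.
by have [[x Kx] _ KZ] := @pos_cone_convex R (E a); rewrite -(scale0r x);
  exact: KZ.
Qed.

Lemma prod_cone_convex : @convex_cone R P prod_cone.
Proof.
split; first by exists 0 => a; exact: pos_cone0.
  move=> x y Kx Ky a; have [_ KD _] := @pos_cone_convex R (E a).
  by apply: KD; [exact: Kx|exact: Ky].
move=> k x k0 Kx a; have [_ _ KZ] := @pos_cone_convex R (E a).
by apply: KZ => //; exact: Kx.
Qed.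

Lemma dsum_cone_convex : convex_cone dsum_cone.
Proof.
split; first by exists 0 => a; exact: pos_cone0.
  move=> x y Kx Ky a; have [_ KD _] := @pos_cone_convex R (E a).
  by apply: KD; [exact: Kx|exact: Ky].
move=> k x k0 Kx a; have [_ _ KZ] := @pos_cone_convex R (E a).
by apply: KZ => //; exact: Kx.
Qed.

Lemma prod_hausdorff : hausdorff_space P.
Proof.
apply: (@hausdorff_product {classic A} F) => a; exact: ptvs_hausdorff.
Qed.

Definition ptvs_prod : preorderedTvs R :=
  @PreorderedTvs R P prod_hausdorff prod_cone prod_cone_convex.

Definition ptvs_lin_dsum : preorderedTvs R :=
  @PreorderedTvs R (lin_dsum F)
    (lin_dsum_hausdorff (fun a => @ptvs_hausdorff R (E a)))
    dsum_cone dsum_cone_convex.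

Definition ptvs_lc_dsum (lcE : forall a, is_locally_convex (E a)) :
    preorderedTvs R :=
  @PreorderedTvs R (lc_dsum F)
    (lc_dsum_hausdorff lcE (fun a => @ptvs_hausdorff R (E a)))
    dsum_cone dsum_cone_convex.

End PreorderedSums.

(* Main.v *)
Require Import Defs.
From mathcomp Require Import all_boot all_order all_algebra.
From mathcomp Require Import all_classical reals topology.
From HB Require Import structures.
From mathcomp Require Import tvs.

(** Semisimplicity pulls back along jointly injective families of continuous
    positive linear maps [T i : E -> F i]: if [x != 0] then some [T i x] is
    nonzero, a continuous positive functional [f] on [F i] detects it, and
    [f \o T i] is a continuous positive functional on [E] that detects [x]
    ([semisimple_pullback]).

    Every implication is an instance of this principle. The coordinate
    projections of the product and of both direct sums are jointly injective,
    continuous and positive, so semisimplicity passes from the factors to the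
    three constructions. Each canonical injection of a factor is by itself
    injective, continuous and positive, so semisimplicity passes back to the
    factors.

    Only the continuity of the projections of a direct sum needs an argument,
    since its topology is defined by a maximality property. The topology that
    the projection to [E b] induces on the sum is a vector topology, convex when
    [E b] is locally convex, and it makes all injections continuous because the
    composites [E a -> E b] are the identity or zero ([dsum_proj_inj_continuous]).
    It is therefore coarser than the finest such topology, which is exactly the
    continuity of the projection. *)

Set Implicit Arguments.
Unset Strict Implicit.
Unset Printing Implicit Defensive.

Import GRing.Theory.
Local Open Scope classical_set_scope.
Local Open Scope ring_scope.

(** The maps are given as bare functions with a linearity proof because the
    same underlying function is used on the algebraic direct sum and on its
    two topologized copies. *)
Lemma semisimple_pullback (R : realType) (I : Type) (E : topologicalLmodType R)
    (F : I -> topologicalLmodType R) (T : forall i, E -> F i)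
    (K : set E) (L : forall i, set (F i)) :
  (forall i, linear (T i)) -> (forall i, continuous (T i)) ->
  (forall i, K `<=` T i @^-1` L i) ->
  (forall x, (forall i, T i x = 0) -> x = 0) ->
  (forall i, semisimple (L i)) -> semisimple K.
Proof.
move=> linT cT posT injT ssL x x0.
have [i Tx0] : exists i, T i x != 0.
  apply: contrapT => /forallNP T0; move/eqP: x0; apply; apply: injT => i.
  by apply/eqP; apply: contrapT => /negP; exact: T0.
have [f [cf posf fTx0]] := ssL i _ Tx0.
pose Ti : {linear E -> F i} :=
  HB.pack (T i) (GRing.isLinear.Build R E (F i) *:%R (T i) (linT i)).
exists (f \o Ti : {scalar E}); split=> //.
  by move=> y; exact: (cvg_comp _ _ (cT i y) (cf _)).
by move=> y Ky; apply: posf; exact: posT.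
Qed.

Lemma semisimple_inj (R : realType) (E F : topologicalLmodType R) (T : E -> F)
    (K : set E) (L : set F) :
  linear T -> continuous T -> K `<=` T @^-1` L ->
  (forall x, T x = 0 -> x = 0) -> semisimple L -> semisimple K.
Proof.
move=> linT cT posT injT ssL.
apply: (@semisimple_pullback R unit E (fun=> F) (fun=> T) K (fun=> L)) => //.
by move=> x /(_ tt) /injT.
Qed.

Lemma dsum_inj_linear (R : realType) (A : Type) (E : A -> lmodType R) (a : A) :
  linear (@dsum_inj R A E a).
Proof.
move=> k u v; apply/val_inj/functional_extensionality_dep => b.
change (dsum_val (dsum_inj a (k *: u + v)) b =
  k *: dsum_val (dsum_inj a u) b + dsum_val (dsum_inj a v) b).
have [<-|ab] := pselect (a = b); first by rewrite !dsum_inj_eq.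
by rewrite !dsum_inj_neq// scaler0 addr0.
Qed.

Lemma dsum_inj_eq0 (R : realType) (A : Type) (E : A -> lmodType R) (a : A)
    (u : E a) : dsum_inj a u = 0 -> u = 0.
Proof. by move=> /(congr1 (dsum_proj a)); rewrite /dsum_proj dsum_inj_eq. Qed.

Section Topology.
Context {R : realType} {A : Type} (E : A -> topologicalLmodType R).

Lemma dsum_proj_inj_continuous (a b : A) :
  continuous (fun u : E a => dsum_proj b (@dsum_inj R A E a u)).
Proof.
have [ab|ab] := pselect (a = b).
  case: _ / ab; rewrite [X in continuous X](_ : _ = id).
    by move=> u; exact: cvg_id.
  by apply/funext => u; exact: dsum_inj_eq.
rewrite [X in continuous X](_ : _ = cst 0); first exact: cst_continuous.
by apply/funext => u; exact: dsum_inj_neq.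
Qed.

Lemma dproj_continuous (a : A) :
  continuous (fun x : prod_topology (fun a => E a : Type) => x a).
Proof. exact: (@proj_continuous {classic A} E). Qed.

Lemma prod_inj_continuous (a : A) :
  continuous (fun u : E a =>
    dsum_val (@dsum_inj R A E a u) : prod_topology (fun a => E a : Type)).
Proof.
move=> u; apply/cvg_sup => b U [_ [[O oO <-] Ox] OU].
apply: filterS OU _; apply: (@dsum_proj_inj_continuous a b u).
exact: open_nbhs_nbhs.
Qed.

Let proj_topology b : Topological (dsum E) :=
  Topological.class (initial_topology (@dsum_proj R A E b)).

Lemma dsum_proj_topology_admissible (b : A) : lin_admissible (proj_topology b).
Proof.
split; first exact: (@initial_vector_topology R (dsum E) (E b) (dsum_proj b)).
move=> a u; apply: (@initial_cvg R (dsum E) (E b) (dsum_proj b)).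
exact: dsum_proj_inj_continuous.
Qed.

Lemma lin_dsum_proj_continuous (b : A) :
  continuous (dsum_proj b : lin_dsum E -> E b).
Proof.
apply/continuousP => U oU.
apply: (lin_dsum_finest (dsum_proj_topology_admissible b)).
by exists U.
Qed.

Lemma lc_dsum_proj_continuous (b : A) : is_locally_convex (E b) ->
  continuous (dsum_proj b : lc_dsum E -> E b).
Proof.
move=> lcE; have [vect injc] := dsum_proj_topology_admissible b.
have adm : lc_admissible (proj_topology b).
  split=> //.
  exact: (@initial_convex_topology R (dsum E) (E b) (dsum_proj b)).
by apply/continuousP => U oU; apply: (lc_dsum_finest adm); exists U.
Qed.

End Topology.

Section Cones.
Context {R : realType} {A : Type} (E : A -> preorderedTvs R).
Local Notation F := (fun a => ptvs_sort (E a)).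

Lemma pos_cone0 (a : A) : pos_cone (E a) 0.
Proof.
have [[x Kx] _ KZ] := @pos_cone_convex R (E a).
by rewrite -(scale0r x); exact: KZ.
Qed.

Lemma dsum_inj_pos (a : A) (u : E a) :
  pos_cone (E a) u -> @dsum_cone R A E (@dsum_inj R A F a u).
Proof.
move=> Ku b; have [<-|ab] := pselect (a = b); first by rewrite dsum_inj_eq.
by rewrite dsum_inj_neq//; exact: pos_cone0.
Qed.

Lemma dsum_proj_inj0 (x : dsum F) : (forall a, dsum_proj a x = 0) -> x = 0.
Proof. by move=> x0; apply/val_inj/functional_extensionality_dep. Qed.

Lemma semisimple_prod : semisimple (pos_cone (ptvs_prod E)) <->
  (forall a, semisimple (pos_cone (E a))).
Proof.
split=> [ssP a|ssE].
  apply: (semisimple_inj (T := fun u : E a =>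
    dsum_val (@dsum_inj R A F a u) : ptvs_prod E)) ssP.
  - by move=> k u v; rewrite dsum_inj_linear.
  - exact: prod_inj_continuous.
  - exact: dsum_inj_pos.
  - by move=> u u0; apply/(@dsum_inj_eq0 R A F a u)/val_inj.
apply: (semisimple_pullback (E := ptvs_prod E) (F := F)
  (T := @dproj R A F)) ssE => //.
- exact: dproj_continuous.
- by move=> a x; exact.
- by move=> x x0; exact: functional_extensionality_dep.
Qed.

Lemma semisimple_lin_dsum : semisimple (pos_cone (ptvs_lin_dsum E)) <->
  (forall a, semisimple (pos_cone (E a))).
Proof.
split=> [ssS a|ssE].
  apply: (semisimple_inj (E := E a) (F := ptvs_lin_dsum E)
    (T := @dsum_inj R A F a)) ssS.
  - exact: dsum_inj_linear.
  - by have [_] := lin_dsum_admissible F; exact.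
  - exact: dsum_inj_pos.
  - exact: dsum_inj_eq0.
apply: (semisimple_pullback (E := ptvs_lin_dsum E) (F := F)
  (T := @dsum_proj R A F)) ssE => //.
- exact: lin_dsum_proj_continuous.
- by move=> a x; exact.
- exact: dsum_proj_inj0.
Qed.

Lemma semisimple_lc_dsum (lcE : forall a, is_locally_convex (E a)) :
  semisimple (pos_cone (ptvs_lc_dsum lcE)) <->
  (forall a, semisimple (pos_cone (E a))).
Proof.
split=> [ssS a|ssE].
  apply: (semisimple_inj (E := E a) (F := ptvs_lc_dsum lcE)
    (T := @dsum_inj R A F a)) ssS.
  - exact: dsum_inj_linear.
  - by have [_ _] := lc_dsum_admissible F; exact.
  - exact: dsum_inj_pos.
  - exact: dsum_inj_eq0.
apply: (semisimple_pullback (E := ptvs_lc_dsum lcE) (F := F)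
  (T := @dsum_proj R A F)) ssE => //.
- by move=> a; exact: lc_dsum_proj_continuous.
- by move=> a x; exact.
- exact: dsum_proj_inj0.
Qed.

End Cones.

Theorem proposition6p2 (R : realType) (A : Type) (E : A -> preorderedTvs R) :
  [/\ semisimple (pos_cone (ptvs_lin_dsum E)) <->
        semisimple (pos_cone (ptvs_prod E)),
      semisimple (pos_cone (ptvs_prod E)) <->
        (forall a : A, semisimple (pos_cone (E a))) &
      forall lcE : (forall a : A, is_locally_convex (E a)),
        semisimple (pos_cone (ptvs_lc_dsum lcE)) <->
          (forall a : A, semisimple (pos_cone (E a)))].
Proof.
split; last exact: semisimple_lc_dsum.
- exact: iff_trans (semisimple_lin_dsum E) (iff_sym (semisimple_prod E)).
- exact: semisimple_prod.
Qed.
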